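(* Let $f_{\mathrm{Ind}}(s,k)$ be as defined in the context. Then: (a) there exists a constant $c>0$ such that for all integers $k\ge 2$, $f_{\mathrm{Ind}}(k,k)\ge k^{ck}$; (b) for each fixed integer $k\ge 2$, $f_{\mathrm{Ind}}(s,k)\ge s^{(1/4-o(1))(k^2-3k-2)}$, where $o(1)$ denotes a quantity tending to $0$ as $s\to\infty$; (c) for each fixed integer $s\ge 2$, $f_{\mathrm{Ind}}(s,k)\ge k^{(1/2-o(1))s-1}$, where $o(1)$ denotes a quantity tending to $0$ as $k\to\infty$.
   Context: All graphs are finite, simple and loopless; the average degree of $G$ is $d(G)=2|E(G)|/|V(G)|$. A graph is $H$-free if it has no (not necessarily induced) subgraph isomorphic to $H$. For positive integers $s,k$, $f_{\mathrm{Ind}}(s,k)$ denotes the least integer $D$ such that every $K_{s,s}$-free graph $G$ with $d(G)\ge D$ contains an induced subgraph which is $C_4$-free and has average degree at least $k$. *)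

(* Defs.v *)
From HB Require Import structures.
From mathcomp Require Import all_boot all_order all_algebra.
From mathcomp Require Import all_classical all_reals all_analysis.
Set Implicit Arguments.
Unset Strict Implicit.
Unset Printing Implicit Defensive.
Import Order.TTheory GRing.Theory Num.Theory.
Import numFieldNormedType.Exports.
Local Open Scope classical_set_scope.
Local Open Scope ring_scope.

Record sgraph := SGraph {
  vertex :> finType;
  adj : rel vertex;
  adj_sym : symmetric adj;
  adj_irrefl : irreflexive adj }.

Definition edges (G : sgraph) : {set {set G}} :=
  [set [set p.1; p.2]%SET | p : G * G & adj p.1 p.2]%SET.

(* The null graph gets average degree 0, since 0^-1 = 0 in rat. *)
Definition avgdeg (G : sgraph) : rat := (2 * #|edges G|)%N%:R / #|G|%:R.

Definition contains (H G : sgraph) : Prop :=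
  exists f : H -> G, injective f /\ forall x y, adj x y -> adj (f x) (f y).

Definition free (H G : sgraph) : Prop := ~ contains H G.

Section Induced.
Variables (G : sgraph) (S : {set G}).
Definition induced_adj : rel {x : G | x \in S} :=
  fun x y => adj (val x) (val y).
Lemma induced_adj_sym : symmetric induced_adj.
Proof. by move=> x y; exact: adj_sym. Qed.
Lemma induced_adj_irrefl : irreflexive induced_adj.
Proof. by move=> x; exact: adj_irrefl. Qed.
Definition induced : sgraph := SGraph induced_adj_sym induced_adj_irrefl.
End Induced.

Section CompleteBipartite.
Variables s t : nat.
Definition Kst_adj : rel ('I_s + 'I_t) :=
  fun x y => match x, y with
             | inl _, inr _ | inr _, inl _ => true
             | _, _ => false
             end.
Lemma Kst_adj_sym : symmetric Kst_adj.
Proof. by move=> [x|x] [y|y]. Qed.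
Lemma Kst_adj_irrefl : irreflexive Kst_adj.
Proof. by move=> [x|x]. Qed.
Definition Kst : sgraph := SGraph Kst_adj_sym Kst_adj_irrefl.
End CompleteBipartite.

(* ordS is the successor modulo 4. *)
Definition C4_adj : rel 'I_4 := fun x y => (y == ordS x) || (x == ordS y).
Lemma C4_adj_sym : symmetric C4_adj.
Proof. by move=> x y; exact: orbC. Qed.
Lemma C4_adj_irrefl : irreflexive C4_adj.
Proof. by move=> [[|[|[|[|x]]]] hx]. Qed.
Definition C4 : sgraph := SGraph C4_adj_sym C4_adj_irrefl.

Definition f_Ind_bound (s k : nat) : set int :=
  [set D : int | forall G : sgraph,
     free (Kst s s) G -> D%:~R <= avgdeg G ->
     exists S : {set G}, free C4 (induced S) /\ k%:R <= avgdeg (induced S)].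

(* The least element of f_Ind_bound s k, as an infimum in \bar R, so that no
   proof that f_Ind_bound s k is nonempty is needed to define it; see
   f_Ind_least. For s, k > 0 the one-vertex graph shows that f_Ind_bound s k
   contains positive integers only. *)
Definition f_Ind (R : realType) (s k : nat) : \bar R :=
  ereal_inf [set (D%:~R)%:E | D in f_Ind_bound s k].

Lemma f_Ind_least (R : realType) (s k : nat) (D : int) :
  f_Ind_bound s k D -> (forall D', f_Ind_bound s k D' -> D <= D') ->
  f_Ind R s k = (D%:~R)%:E.
Proof.
move=> hD hmin; apply/eqP; rewrite eq_le; apply/andP; split.
  by apply: ereal_inf_lbound; exists D.
by apply: le_ereal_inf_tmp => _ [D' hD' <-]; rewrite lee_fin ler_int; exact: hmin.
Qed.

(* Main.v *)
Require Import Defs.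
From HB Require Import structures.
From mathcomp Require Import all_boot all_order all_algebra.
From mathcomp Require Import all_classical all_reals all_analysis.
From mathcomp Require Import zify ring lra.
Set Implicit Arguments.
Unset Strict Implicit.
Unset Printing Implicit Defensive.
Import Order.TTheory GRing.Theory Num.Theory.
Import numFieldNormedType.Exports.
Local Open Scope classical_set_scope.
Local Open Scope ring_scope.

(* A C_4-free graph on m vertices of average degree at least k has
   m > k (k - 1), and at most C(m, 2) / (k - 1) edges. So it is enough that the
   random graph G(n, p) has no K_{s,s}, and that all its vertex sets of size
   m > k (k - 1), as well as its whole vertex set, span more than
   C(m, 2) / (k - 1) edges; its average degree is then more than
   (n - 1) / (k - 1). By union bounds this happens with positive probability
   - for p = 4/k up to rounding and n about (k/4)^(s/2) / 2, which gives (c);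
   - for s = k, p = k^(-1/4) up to rounding and n = p^(-k/2) up to a constant
     power of p, which gives (a);
   - for p = 1 - s^(-1/2) up to rounding and n about s^((k^2 - 3k)/4), which
     gives (b).
   For bounded k or s, only f_Ind(s, k) >= min(k, 2s - 1) is used, which the
   complete graphs give. *)

(** * Degree sums, and edges of C_4-free graphs *)

Lemma sum_adj (G : sgraph) :
  (\sum_(x : G) \sum_(y : G) adj x y = 2 * #|edges G|)%N.
Proof.
rewrite pair_big /=.
transitivity (\sum_(p : G * G | adj p.1 p.2) 1)%N.
  by rewrite [RHS]big_mkcond.
(* Each edge is hit by exactly two ordered pairs, [(u, v)] and [(v, u)]. *)
rewrite (partition_big (fun p : G * G => [set p.1; p.2]%SET) (mem (edges G))) /=; last first.
  by move=> p pP; apply/imsetP; exists p; rewrite ?inE.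
rewrite mulnC -sum_nat_const; apply: eq_bigr => e /imsetP[[u v] /= uv ->].
have uv' : adj u v by move: uv; rewrite inE.
have nuv : u != v by apply/eqP => E; move: uv'; rewrite E adj_irrefl.
rewrite sum1_card.
transitivity #|[set (u, v); (v, u)]%SET|; last first.
  by rewrite cards2 xpair_eqE (negbTE nuv).
apply: eq_card => -[x y]; rewrite unfold_in /= !inE /= !xpair_eqE.
apply/andP/orP => [[xy /eqP E]|].
  have : x \in [set u; v]%SET by rewrite -E !inE eqxx.
  have : y \in [set u; v]%SET by rewrite -E !inE eqxx orbT.
  have nxy : x != y by apply/eqP => E'; move: xy; rewrite E' adj_irrefl.
  rewrite !inE => /orP[]/eqP yE /orP[]/eqP xE; move: nxy; rewrite xE yE ?eqxx //; by [left|right].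
case=> /andP[/eqP-> /eqP->]; first by rewrite uv'.
by rewrite adj_sym uv' finset.setUC.
Qed.

(** Two common neighbours [u], [v] would close the 4-cycle [x], [u], [y], [v]. *)
Lemma C4_free_codeg (G : sgraph) (x y : G) : Defs.free C4 G -> x != y ->
  (\sum_(z : G) adj z x * adj z y <= 1)%N.
Proof.
move=> C4G xy.
rewrite (eq_bigr (fun z : G => nat_of_bool (adj z x && adj z y)));
  last by move=> z _; rewrite mulnb.
rewrite -big_mkcond sum1_card leqNgt; apply/negP => /card_gt1P[u [v []]].
rewrite !unfold_in /= => /andP[ux uy] /andP[vx vy] uv; apply: C4G.
have adjN (a b : G) : adj a b -> (a == b) = false.
  by move=> ab; apply/eqP => E; move: ab; rewrite E adj_irrefl.
pose h (i : 'I_4) := nth x [:: x; u; y; v] i.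
have us : uniq [:: x; u; y; v].
  by rewrite /= !inE (eq_sym x u) (eq_sym x v) (eq_sym y v) 
             (adjN u x) // (adjN v x) // (adjN u y) // (adjN v y) //
             (negbTE xy) (negbTE uv).
exists h; split.
  move=> i j /eqP; rewrite /h nth_uniq // => /eqP ij; exact: val_inj.
by move=> [[|[|[|[|i]]]] hi] [[|[|[|[|j]]]] hj] //= _; rewrite /h //= adj_sym.
Qed.

(** Double counting of pairs of neighbours of [z]: the diagonal pairs contribute the degree sum,
    each other pair at most 1. Adding [#|G|] on the left avoids a truncated subtraction. *)
Lemma C4_free_sum_deg2 (G : sgraph) : Defs.free C4 G ->
  (\sum_(z : G) (\sum_(x : G) adj z x) ^ 2 + #|G|
     <= \sum_(x : G) \sum_(y : G) adj x y + #|G| ^ 2)%N.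
Proof.
move=> C4G.
rewrite (eq_bigr (fun z : G => \sum_(x : G) \sum_(y : G) adj z x * adj z y)%N); last first.
  by move=> z _; rewrite -mulnn big_distrlr.
rewrite exchange_big /=.
rewrite (eq_bigr (fun x : G => \sum_(y : G) \sum_(z : G) adj z x * adj z y)%N); last first.
  by move=> x _; rewrite exchange_big.
have -> : (#|G| ^ 2 = \sum_(x : G) #|G|)%N by rewrite sum_nat_const mulnn.
rewrite -{1}sum1_card -!big_split /=; apply: leq_sum => x _.
rewrite (bigD1 x) //= -addnA leq_add //.
  by apply: leq_sum => z _; rewrite mulnb andbb adj_sym.
rewrite -[#|G|]sum1_card [leqRHS](bigD1 x) //= addnC leq_add2l.
by apply: leq_sum => y yx; apply: C4_free_codeg; rewrite // eq_sym.
Qed.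

Lemma avgdeg_ge (G : sgraph) (k : nat) : (0 < k)%N -> k%:R <= avgdeg G ->
  (0 < #|G|)%N /\ (k * #|G| <= 2 * #|edges G|)%N.
Proof.
move=> k0; rewrite /avgdeg; have [->|G0] := posnP #|G|.
  by rewrite invr0 mulr0 lern0; case: k k0.
by rewrite ler_pdivlMr ?ltr0n // -natrM ler_nat.
Qed.

(* Sum [d (d - k) >= k (d - k)] over the degrees [d]. *)
Lemma C4_free_bound (G : sgraph) (k : nat) : (0 < k)%N ->
  Defs.free C4 G -> k%:R <= avgdeg G ->
  (k * k.-1 < #|G|)%N /\ (k.-1 * (2 * #|edges G|) <= #|G| * #|G|.-1)%N.
Proof.
move=> k0 C4G /(avgdeg_ge k0)[G0 kG].
have := C4_free_sum_deg2 C4G; rewrite -sum_adj in kG *.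
set T := (\sum_x \sum_y _)%N in kG *; set m := #|G| in kG G0 * => sq.
have : (2 * k * T <= \sum_(z : G) (\sum_(x : G) adj z x) ^ 2 + k ^ 2 * m)%N.
  rewrite /T big_distrr /= [X in (_ + X)%N]mulnC -sum_nat_const -big_split /=.
  apply: leq_sum => z _; rewrite -mulnA addnC.
  by have [] := nat_Cauchy k (\sum_(y : G) adj z y).
(* Together, [(2 k - 1) T <= m (m - 1) + k^2 m]. Inserting [k m <= T] and cancelling [m] gives the
   first bound; subtracting [k^2 m <= k T] gives the second. *)
nia.
Qed.

(** Moves the edges from the subtype to vertex sets of [G], where the random graph counts them. *)
Lemma card_edges_induced (G : sgraph) (S : {set G}) :
  #|edges (Defs.induced S)| = #|[set e in edges G | e \subset S]%SET|.
Proof.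
have vinj : injective (val : Defs.induced S -> G) by exact: val_inj.
rewrite -(card_imset (mem (edges (Defs.induced S))) (imset_inj vinj)).
apply: eq_card => e; rewrite !inE; apply/imsetP/andP.
  move=> [e' /imsetP[[x y] /=]]; rewrite inE /= => xy -> ->.
  rewrite imsetU1 imset_set1; split.
    by apply/imsetP; exists (val x, val y); rewrite ?inE.
  by apply/fintype.subsetP => z; rewrite !inE => /orP[]/eqP->; exact: valP.
case=> /imsetP[[x y] /=]; rewrite inE /= => xy -> /fintype.subsetP sub.
have xS : x \in S by apply: sub; rewrite !inE eqxx.
have yS : y \in S by apply: sub; rewrite !inE eqxx orbT.
exists [set (exist _ x xS : Defs.induced S); (exist _ y yS : Defs.induced S)]%SET.
  apply/imsetP; exists (exist _ x xS : Defs.induced S, exist _ y yS : Defs.induced S) => //.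
  by rewrite inE.
by rewrite imsetU1 imset_set1.
Qed.

(** * The random graph as a uniform labelling of vertex sets *)

Section RandomGraph.
Variables (n a b : nat).
Implicit Types (f : {ffun {set 'I_n} -> 'I_b}) (S : {set 'I_n}).

Definition er_adj f : rel 'I_n :=
  fun x y => (x != y) && (f [set x; y]%SET < a)%N.
Lemma er_adj_sym f : symmetric (er_adj f).
Proof. by move=> x y; rewrite /er_adj eq_sym finset.setUC. Qed.
Lemma er_adj_irrefl f : irreflexive (er_adj f).
Proof. by move=> x; rewrite /er_adj eqxx. Qed.

(* With [f] uniform, [er_graph f] is the Erdos-Renyi graph G(n, a/b). The values
   of [f] at sets that are not pairs are irrelevant. *)
Definition er_graph f : sgraph := SGraph (er_adj_sym f) (er_adj_irrefl f).

Definition pairs S := [set e : {set 'I_n} | e \subset S & #|e| == 2]%SET.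

Lemma card_pairs S : #|pairs S| = 'C(#|S|, 2).
Proof. exact: cards_draws. Qed.

Lemma edges_er_graph f S :
  [set e in edges (er_graph f) | e \subset S]%SET = [set e in pairs S | (f e < a)%N]%SET.
Proof.
apply/setP => e; rewrite !inE andbC -!andbA; congr andb.
apply/imsetP/andP => [[[x y]]|[/cards2P[x [y [xy exy]]] fe]].
  by rewrite inE /= => /andP[xy fxy] ->; rewrite cards2 xy.
by rewrite exy in fe *; exists (x, y); rewrite ?inE //= /er_adj xy.
Qed.

End RandomGraph.

(** * Probabilities as counts of labellings *)

(** Independence: the expectation of a product over [A] is the product of the expectations, with
    denominators cleared to stay in [nat]. *)
Lemma sum_prod_ffun (T : finType) (b : nat) (A : {set T}) (w : 'I_b -> nat) :
  (b ^ #|A| * \sum_(f : {ffun T -> 'I_b}) \prod_(e in A) w (f e)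
   = (\sum_v w v) ^ #|A| * #|{ffun T -> 'I_b}|)%N.
Proof.
pose F e v := if e \in A then w v else 1%N.
rewrite (eq_bigr (fun f : {ffun T -> 'I_b} => \prod_e F e (f e))%N); last first.
  by move=> f _; rewrite [LHS]big_mkcond.
rewrite -(bigA_distr_bigA F) (bigID (mem A)) /=.
rewrite (eq_bigr (fun=> \sum_v w v)%N); last first.
  by move=> e eA; apply: eq_bigr => v _; rewrite /F eA.
rewrite [X in (_ * (_ * X))%N](eq_bigr (fun=> b)); last first.
  move=> e eA; rewrite (eq_bigr (fun=> 1%N)) ?sum1_card ?card_ord //.
  by move=> v _; rewrite /F (negbTE eA).
rewrite !prod_nat_const card_ffun card_ord mulnCA -expnD; congr (_ * b ^ _)%N.
by rewrite -(cardC (mem A)); congr addn; apply: eq_card => e; rewrite !inE.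
Qed.

Lemma sum_ltn_ord (a b : nat) (u v : nat) : (a <= b)%N ->
  (\sum_(i < b) (if (i < a)%N then u else v) = a * u + (b - a) * v)%N.
Proof.
move=> ab; rewrite -(big_mkord xpredT (fun i => if (i < a)%N then u else v)).
rewrite (@big_cat_nat _ _ _ a) //=; congr addn.
  rewrite big_nat (eq_bigr (fun=> u)) -?big_nat ?sum_nat_const_nat ?subn0 //.
  by move=> i /= ->.
rewrite big_nat (eq_bigr (fun=> v)) -?big_nat ?sum_nat_const_nat //.
by move=> i /andP[/leq_gtF ->].
Qed.

Section Union.
Variables (n a b : nat).
Hypothesis (b0 : (0 < b)%N) (ab : (a <= b)%N).
Let Omega := {ffun {set 'I_n} -> 'I_b}.

(** Independence for the 0/1 weight that indicates an edge: the probability is [(a / b) ^ #|A|]. *)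
Lemma card_all_edges (A : {set {set 'I_n}}) :
  (b ^ #|A| * #|[set f : Omega | [forall e in A, f e < a]%N]%SET|
    = a ^ #|A| * #|{: Omega}|)%N.
Proof.
transitivity (b ^ #|A| * \sum_(f : Omega) \prod_(e in A) (if f e < a then 1 else 0))%N.
  congr muln; rewrite -sum1_card big_mkcond; apply: eq_bigr => f _; rewrite inE.
  case: (boolP [forall _ in _, _]) => [/forall_inP h|].
    by rewrite big1 // => e /h ->.
  rewrite negb_forall => /existsP[e]; rewrite negb_imply => /andP[eA /negbTE fe].
  by rewrite (bigD1 e) //= fe mul0n.
rewrite (sum_prod_ffun A (fun v : 'I_b => if (v < a)%N then 1 else 0)%N).
rewrite (@sum_ltn_ord a b 1 0) // muln0 muln1 addn0 //.
Qed.

Definition Kst_pairs (s : nat) (g : 'I_s + 'I_s -> 'I_n) : {set {set 'I_n}} :=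
  [set [set g (inl p.1); g (inr p.2)]%SET | p : 'I_s * 'I_s]%SET.

Lemma card_Kst_pairs s (g : 'I_s + 'I_s -> 'I_n) : injective g ->
  #|Kst_pairs g| = (s * s)%N.
Proof.
move=> ginj; rewrite card_imset ?card_prod ?card_ord // => -[i j] [i' j'] /= E.
have : g (inl i) \in [set g (inl i'); g (inr j')]%SET by rewrite -E !inE eqxx.
have : g (inr j) \in [set g (inl i'); g (inr j')]%SET by rewrite -E !inE eqxx orbT.
by rewrite !inE !(inj_eq ginj) /= => /eqP[->] /orP[/eqP[->]|].
Qed.

(** Union bound over at most [n ^ (2 s)] embeddings, each realised with probability
    [(a / b) ^ (s ^ 2)]: the sum is at most [(n ^ 2 (a / b) ^ s) ^ s <= (1/4) ^ s]. *)
Lemma card_not_Kst_free (s : nat) : (0 < s)%N -> (4 * n ^ 2 * a ^ s <= b ^ s)%N ->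
  (4 * #|[set f : Omega | `[< contains (Kst s s) (er_graph a f) >] ]%SET| <= #|{: Omega}|)%N.
Proof.
move=> s0 hs.
pose X (g : {ffun 'I_s + 'I_s -> 'I_n}) :=
  [set f : Omega | [forall e in Kst_pairs g, f e < a]%N]%SET.
have sub : (#|[set f : Omega | `[< contains (Kst s s) (er_graph a f) >] ]%SET|
    <= \sum_(g : {ffun 'I_s + 'I_s -> 'I_n} | injectiveb g) #|X g|)%N.
  apply: (@leq_trans #|\bigcup_(g : {ffun 'I_s + 'I_s -> 'I_n} | injectiveb g) X g|); last first.
    by apply: (big_ind2 (fun (A : {set Omega}) m => #|A| <= m)%N) => [|A m B p Am Bp|//];
       [rewrite cards0 | rewrite (leq_trans (leq_card_setU _ _)) ?leq_add].
  apply/subset_leq_card/fintype.subsetP => f; rewrite inE => /asboolP[h [hinj hadj]].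
  apply/bigcupP; exists [ffun x => h x]; first by apply/injectiveP => x y; rewrite !ffunE => /hinj.
  rewrite inE; apply/forall_inP => e /imsetP[[i j] _ ->]; rewrite !ffunE.
  by have /andP[] := hadj (inl i) (inr j) isT.
have bs : (0 < b ^ (s * s))%N by rewrite expn_gt0 b0.
rewrite -(leq_pmul2l bs).
apply: (@leq_trans (4 * (\sum_(g : {ffun 'I_s + 'I_s -> 'I_n} | injectiveb g)
  (a ^ (s * s) * #|{: Omega}|)))%N).
  rewrite mulnCA leq_mul2l /=; apply: leq_trans (leq_mul (leqnn _) sub) _.
  rewrite big_distrr /=; apply: leq_sum => g /injectiveP ginj.
  by rewrite -(card_Kst_pairs ginj) card_all_edges.
rewrite sum_nat_const mulnA mulnA leq_mul2r; apply/orP; right.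
apply: (@leq_trans (4 * (n ^ 2) ^ s * (a ^ s) ^ s)%N).
  rewrite -!expnM leq_mul2r; apply/orP; right; rewrite leq_mul2l /=.
  apply: leq_trans (max_card _) _.
  by rewrite card_ffun card_sum !card_ord mul2n addnn.
rewrite expnM -[(4 * _ * _)%N]mulnA -expnMn.
apply: (@leq_trans ((4 * n ^ 2 * a ^ s) ^ s)); last by rewrite leq_exp2r.
by rewrite -mulnA [leqRHS]expnMn leq_mul2r -[leqLHS]expn1 leq_exp2l ?s0 ?orbT.
Qed.

(** Exponential Markov inequality with weight [t] per non-edge: at most [E] edges leave at least
    [#|A| - E] non-edges. *)
Lemma card_few_edges (A : {set {set 'I_n}}) (t E : nat) : (0 < t)%N -> (E <= #|A|)%N ->
  (b ^ #|A| * t ^ (#|A| - E) * #|[set f : Omega | #|[set e in A | f e < a]%N%SET| <= E]%N%SET|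
    <= (a + (b - a) * t) ^ #|A| * #|{: Omega}|)%N.
Proof.
move=> t0 EA; have -> : (a + (b - a) * t = \sum_(v < b) (if (v < a)%N then 1 else t))%N.
  by rewrite sum_ltn_ord ?muln1.
rewrite -(sum_prod_ffun A (fun v : 'I_b => if (v < a)%N then 1%N else t)) -mulnA leq_mul2l.
apply/orP; right; rewrite [leqLHS]mulnC -sum_nat_const [leqLHS]big_mkcond /=.
apply: leq_sum => f _; rewrite inE; case: ifP => // fE.
rewrite (bigID (fun e => f e < a)%N) /= big1 ?mul1n; last by move=> e /andP[_ ->].
rewrite (eq_bigr (fun=> t)); last by move=> e /andP[_ /negbTE ->].
rewrite prod_nat_const leq_pexp2l // leq_subLR.
rewrite -(cardsID [set e in A | (f e < a)%N]%SET A) leq_add //.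
  by apply: leq_trans fE; apply: subset_leq_card; apply: finset.subsetIr.
apply: subset_leq_card; apply/fintype.subsetP => e; rewrite !inE => /andP[+ eA].
by rewrite eA => fe; apply/andP.
Qed.

End Union.

(** * Existence of a suitable graph *)

(** Induction on [n], since [(1 + z) (1 - (n + 1) z) <= 1 - n z]. It bounds powers from above for
    [z] of either sign. *)
Lemma expr1D_le (R : realFieldType) (z : R) (n : nat) : -1 <= z ->
  (1 + z) ^+ n * (1 - n%:R * z) <= 1.
Proof.
move=> z0; elim: n => [|n IH]; first by rewrite expr0; lra.
apply: le_trans IH; rewrite exprS.
have h : 0 <= (1 + z) ^+ n by rewrite exprn_ge0 // addrC -lerBlDr sub0r.
rewrite [(1 + z) * _]mulrC -mulrA ler_wpM2l // -natr1.
have := mulr_ge0 (ler0n R n) (sqr_ge0 z); have := sqr_ge0 z; nra.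
Qed.

Lemma sum_expr_card (R : comNzRingType) (n : nat) (z : R) :
  \sum_(S : {set 'I_n}) z ^+ #|S| = (z + 1) ^+ n.
Proof.
transitivity (\prod_(i < n) (z + 1)); last by rewrite prodr_const card_ord.
rewrite bigA_distr /=; apply: eq_bigr => S _.
by rewrite -big_mkcond /= prodr_const.
Qed.

Lemma mul2_bin2 (m : nat) : (m * m.-1 = 'C(m, 2) * 2)%N.
Proof.
by case: m => [|m] //; rewrite bin2 muln2 even_halfK //= oddM /= andNb.
Qed.

Section Exists.
Variables (R : realFieldType) (n a b s k t : nat).
Hypotheses (b0 : (0 < b)%N) (ab : (a <= b)%N) (s0 : (0 < s)%N) (k1 : (1 < k)%N).
Hypotheses (t0 : (0 < t)%N) (n0 : (0 < n)%N).
Let Omega := {ffun {set 'I_n} -> 'I_b}.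

(* A set of [N] pairs carries at most [N / (k - 1)] edges with probability at
   most [x ^ (N / (k - 1))], [x] being the following number: bound the
   probability by the expectation of [t ^ (N / (k - 1) - number of edges)]. *)
Definition chernoff_base : R := ((a + (b - a) * t)%:R / (b * t)%:R) ^+ k.-1 * t%:R.

Definition few_edges (S : {set 'I_n}) : {set Omega} :=
  [set f : Omega | k.-1 * (2 * #|[set e in pairs S | f e < a]%N%SET|) <= #|S| * #|S|.-1]%N%SET.

(** The power [k.-1] avoids fractional exponents: the Markov bound carries [t ^ E] with [E] the
    floor of [N / (k - 1)], and [E (k - 1) <= N]. *)
Lemma card_few_edges_le S :
  (#|few_edges S|%:R / #|{: Omega}|%:R : R) ^+ k.-1 <= chernoff_base ^+ 'C(#|S|, 2).
Proof.
set m := #|S|; set N := 'C(m, 2).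
have N2 : (m * m.-1 = 2 * N)%N by rewrite mul2_bin2 mulnC.
set E := (N %/ k.-1)%N.
have EN : (E <= N)%N by rewrite leq_div.
have O0 : 0 < #|{: Omega}|%:R :> R.
  by rewrite ltr0n card_ffun card_ord expn_gt0 b0.
have main : (b ^ N * t ^ (N - E) * #|few_edges S| <= (a + (b - a) * t) ^ N * #|{: Omega}|)%N.
  have := @card_few_edges n a b ab (pairs S) t E t0.
  rewrite card_pairs -/m -/N => /(_ EN); apply: leq_trans.
  rewrite leq_mul2l; apply/orP; right; apply: subset_leq_card.
  apply/fintype.subsetP => f; rewrite !inE leq_divRL; last by lia.
  by rewrite -/m N2 mulnCA leq_pmul2l // mulnC.
have bR : 0 < b%:R :> R by rewrite ltr0n.
have tR : 0 < t%:R :> R by rewrite ltr0n.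
rewrite /chernoff_base; set A := (a + (b - a) * t)%N in main *.
have p_le : #|few_edges S|%:R / #|{: Omega}|%:R <= (A%:R / (b * t)%:R) ^+ N * t%:R ^+ E :> R.
  rewrite ler_pdivrMr // expr_div_n natrM exprMn.
  rewrite mulrAC -mulrA mulrAC mulrA ler_pdivlMr ?mulr_gt0 ?exprn_gt0 //.
  move: main; rewrite -(ler_nat R) !natrM !natrX => main.
  have -> : t%:R ^+ N = t%:R ^+ (N - E) * t%:R ^+ E :> R by rewrite -exprD subnK.
  have : 0 <= t%:R ^+ E :> R by rewrite exprn_ge0 ?ltW.
  move=> /(ler_wpM2r) /(_ _ _ main); lra.
apply: le_trans (lerXn2r _ _ _ p_le) _; rewrite ?nnegrE ?mulr_ge0 ?exprn_ge0 ?divr_ge0 ?ler0n //.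
rewrite !exprMn -!exprM [(k.-1 * N)%N]mulnC ler_wpM2l ?exprn_ge0 ?divr_ge0 ?ler0n //.
by rewrite ler_weXn2l ?ler1n // leq_divM.
Qed.

Hypothesis x_half : chernoff_base <= 2^-1.
Hypothesis x_pow : (4 * n)%:R ^+ 2 * chernoff_base ^+ k <= 1.
Hypothesis n_large : (4 * k.-1 <= n * n.-1)%N.

Lemma chernoff_base_ge0 : 0 <= chernoff_base.
Proof. by rewrite mulr_ge0 ?exprn_ge0 ?divr_ge0 ?ler0n. Qed.

Lemma few_edges_setT : (#|few_edges finset.setT|%:R / #|{: Omega}|%:R : R) <= 4^-1.
Proof.
have k0 : (0 < k.-1)%N by lia.
rewrite -(@ler_pXn2r _ k.-1) // ?nnegrE ?divr_ge0 ?ler0n //.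
apply: le_trans (card_few_edges_le _) _; rewrite cardsT card_ord.
have -> : 4^-1 = 2^-1 ^+ 2 :> R by field.
rewrite -exprM; apply: (@le_trans _ _ (2^-1 ^+ 'C(n, 2))).
  by rewrite lerXn2r ?nnegrE ?chernoff_base_ge0 ?invr_ge0.
rewrite ler_wiXn2l ?invr_ge0 ?invf_le1 ?ler1n //.
by have := mul2_bin2 n; lia.
Qed.

(** From [#|S| - 1 >= k (k - 1)], the exponent ['C(#|S|, 2)] is at least [#|S| k (k - 1) / 2], and
    [x_pow] bounds the [k]-th power of the base by [(4 n) ^ -2]. *)
Lemma few_edges_large (S : {set 'I_n}) : (k * k.-1 < #|S|)%N ->
  (#|few_edges S|%:R / #|{: Omega}|%:R : R) <= ((4 * n)%:R^-1) ^+ #|S|.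
Proof.
move=> kS; have k0 : (0 < k.-1)%N by lia.
have y0 : 0 <= (4 * n)%:R^-1 :> R by rewrite invr_ge0.
rewrite -(@ler_pXn2r _ k.-1) // ?nnegrE ?divr_ge0 ?exprn_ge0 ?ler0n //.
(* Squaring clears the 2 in the denominator of the binomial coefficient. *)
rewrite -(@ler_pXn2r _ 2) // ?nnegrE ?exprn_ge0 ?divr_ge0 ?ler0n //.
apply: le_trans (lerXn2r _ _ _ (card_few_edges_le _)) _.
- by rewrite nnegrE exprn_ge0 // divr_ge0.
- by rewrite nnegrE exprn_ge0 // chernoff_base_ge0.
rewrite -[leLHS]exprM -mul2_bin2.
apply: (@le_trans _ _ (chernoff_base ^+ (#|S| * (k * k.-1)))).
  apply: ler_wiXn2l; [exact: chernoff_base_ge0| by apply: le_trans x_half _; lra|].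
  by rewrite leq_mul2l; apply/orP; right; lia.
rewrite -!exprM; have -> : (#|S| * (k * k.-1) = k * (#|S| * k.-1))%N by lia.
have -> : (#|S| * (k.-1 * 2) = 2 * (#|S| * k.-1))%N by lia.
rewrite [leLHS]exprM [leRHS]exprM lerXn2r ?nnegrE ?exprn_ge0 ?chernoff_base_ge0 //.
rewrite exprVn -[leRHS]mul1r ler_pdivlMr ?exprn_gt0 ?ltr0n ?muln_gt0 //.
by rewrite mulrC.
Qed.

Hypothesis K_free : (4 * n ^ 2 * a ^ s <= b ^ s)%N.

(** The failure probabilities are at most 1/4 for a [Kst s s], 1/4 for the whole vertex set and 1/3
    for the large sets. *)
Lemma exists_er_graph : exists f : Omega,
  [/\ Defs.free (Kst s s) (er_graph a f), f \notin few_edges finset.setT &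
      forall S : {set 'I_n}, (k * k.-1 < #|S|)%N -> f \notin few_edges S].
Proof.
pose BK := [set f : Omega | `[< contains (Kst s s) (er_graph a f) >] ]%SET.
pose bad := (BK :|: few_edges finset.setT :|:
  \bigcup_(S : {set 'I_n} | (k * k.-1 < #|S|)%N) few_edges S)%SET.
have O0 : 0 < #|{: Omega}|%:R :> R.
  by rewrite ltr0n card_ffun card_ord expn_gt0 b0.
suff : (#|bad| < #|{: Omega}|)%N.
  move=> lt; have /card_gt0P[f] : (0 < #|~: bad|)%N by rewrite cardsCs finset.setCK subn_gt0.
  rewrite finset.in_setC !finset.in_setU !negb_or => /andP[/andP[fK fT] fS]; exists f; split=> //.
    by move: fK; rewrite finset.in_set => /asboolPn.
  by move=> S kS; apply: contra fS => fS; apply/bigcupP; exists S.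
have hK : #|BK|%:R / #|{: Omega}|%:R <= 4^-1 :> R.
  rewrite ler_pdivrMr // mulrC ler_pdivlMr ?ltr0n // mulrC -natrM ler_nat.
  exact: card_not_Kst_free.
have hS : (#|\bigcup_(S : {set 'I_n} | (k * k.-1 < #|S|)%N) few_edges S|)%:R / #|{: Omega}|%:R
    <= 3^-1 :> R.
  apply: (@le_trans _ _ (\sum_(S : {set 'I_n} | (k * k.-1 < #|S|)%N) ((4 * n)%:R^-1) ^+ #|S|)).
    apply: (@le_trans _ _ (\sum_(S : {set 'I_n} | (k * k.-1 < #|S|)%N)
       #|few_edges S|%:R / #|{: Omega}|%:R)); last by apply: ler_sum => S; exact: few_edges_large.
    rewrite -mulr_suml ler_wpM2r ?invr_ge0 ?ler0n // -natr_sum ler_nat.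
    apply: (big_ind2 (fun (A : {set Omega}) m => #|A| <= m)%N) => [|A m B p Am Bp|//].
      by rewrite cards0.
    by rewrite (leq_trans (leq_card_setU _ _)) ?leq_add.
  have y0 : 0 <= (4 * n)%:R^-1 :> R by rewrite invr_ge0.
  apply: (@le_trans _ _ (\sum_(S : {set 'I_n} | S != finset.set0) ((4 * n)%:R^-1) ^+ #|S|)).
    rewrite [leLHS]big_mkcond [leRHS]big_mkcond; apply: ler_sum => S _.
    case: ifP => [kS|_]; last by case: ifP => // _; rewrite exprn_ge0.
    by case: eqP kS => [->|//]; rewrite cards0.
  have := sum_expr_card n ((4 * n)%:R^-1 : R).
  rewrite (bigD1 finset.set0) //= cards0 expr0 => /(canRL (addKr _)) ->.
  (* With [z = 1 / (4 n)] this gives [(1 + z) ^ n <= 4/3]; the term 1 of the empty set is removed,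
     which leaves 1/3. *)
  have := @expr1D_le R (4 * n)%:R^-1 n (le_trans (lerN10 R) y0); rewrite [1 + _]addrC.
  have -> : n%:R * (4 * n)%:R^-1 = 4^-1 :> R.
    by rewrite natrM; field; rewrite pnatr_eq0 -lt0n.
  lra.
rewrite -(ltr_nat R) -[ltRHS]mul1r -ltr_pdivrMr //.
have hT := few_edges_setT.
apply: (@le_lt_trans _ _ ((#|BK|%:R + #|few_edges finset.setT|%:R +
  #|\bigcup_(S : {set 'I_n} | (k * k.-1 < #|S|)%N) few_edges S|%:R) / #|{: Omega}|%:R)).
  rewrite ler_wpM2r ?invr_ge0 ?ler0n // -!natrD ler_nat.
  apply: leq_trans (leq_card_setU _ _) _; rewrite leq_add2r; exact: leq_card_setU.
rewrite !mulrDl; lra.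
Qed.

End Exists.

(** * From graphs to lower bounds on [f_Ind] *)

(** A smaller [D] would apply to the random graph and yield a C_4-free induced subgraph;
    [C4_free_bound] makes it both large and sparse, which the choice of [f] excludes. *)
Lemma f_Ind_ge (R : realType) (n a b s k t : nat) :
  (0 < b)%N -> (a <= b)%N -> (0 < s)%N -> (1 < k)%N -> (0 < t)%N -> (0 < n)%N ->
  chernoff_base R a b k t <= 2^-1 -> (4 * n)%:R ^+ 2 * chernoff_base R a b k t ^+ k <= 1 ->
  (4 * k.-1 <= n * n.-1)%N -> (4 * n ^ 2 * a ^ s <= b ^ s)%N ->
  ((n.-1%:R / k.-1%:R : R)%:E <= f_Ind R s k)%E.
Proof.
move=> b0 ab s0 k1 t0 n0 x_half x_pow n_large K_free.
have k0 : (0 < k.-1)%N by lia.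
have [f [fK fT fS]] := exists_er_graph b0 ab s0 k1 t0 n0 x_half x_pow n_large K_free.
have edgesS S : [set e in pairs S | (f e < a)%N]%SET =
    [set e in edges (er_graph a f) | e \subset S]%SET.
  by rewrite edges_er_graph.
apply: le_ereal_inf_tmp => _ [D hD <-]; rewrite lee_fin leNgt; apply/negP.
rewrite ltr_pdivlMr ?ltr0n //.
rewrite -(mulrz_nat k.-1) -(mulrz_nat n.-1) -intrM ltr_int => ltD.
have [|S [C4S kS]] := hD (er_graph a f) fK.
  rewrite /avgdeg /= card_ord ler_pdivlMr ?ltr0n //.
  move: fT; rewrite inE -ltnNge cardsT card_ord edgesS.
  have -> : [set e in edges (er_graph a f) | e \subset finset.setT]%SET = edges (er_graph a f).
    by apply/setP => e; rewrite !inE finset.subsetT andbT.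
  move=> ltn.
  rewrite -(mulrz_nat n) -(mulrz_nat (2 * _)) -intrM ler_int.
  rewrite -(@ler_pM2r _ k.-1%:R) ?ltr0n // mulrAC.
  apply: (@le_trans _ _ (n.-1%:R * n%:R)); first by rewrite ler_pM2r ?ltr0n ?ltW.
  by rewrite -!natrM ler_nat (mulnC n.-1) (mulnC _ k.-1) ltnW.
have [|mk em] := C4_free_bound _ C4S kS; first lia.
have cS : #|Defs.induced S| = #|S| by rewrite card_sig.
rewrite cS in mk em; have /negP := fS S mk; apply.
by rewrite inE edgesS; rewrite card_edges_induced in em; exact: em.
Qed.

Lemma edges_le (G : sgraph) : (2 * #|edges G| <= #|G| * #|G|.-1)%N.
Proof.
rewrite -sum_adj -sum_nat_const; apply: leq_sum => x _.
rewrite (bigD1 x) //= adj_irrefl add0n -(cardC1 x) -sum1_card.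
by apply: leq_sum => y _; case: adj.
Qed.

Section Complete.
Variable m : nat.
Definition complete_adj : rel 'I_m := fun x y => x != y.
Lemma complete_adj_sym : symmetric complete_adj.
Proof. by move=> x y; rewrite /complete_adj eq_sym. Qed.
Lemma complete_adj_irrefl : irreflexive complete_adj.
Proof. by move=> x; rewrite /complete_adj eqxx. Qed.
Definition complete := SGraph complete_adj_sym complete_adj_irrefl.

Lemma avgdeg_complete : (0 < m)%N -> avgdeg complete = m.-1%:R.
Proof.
move=> m0; rewrite /avgdeg -sum_adj /= card_ord.
rewrite (eq_bigr (fun=> m.-1)) => [|x _].
  by rewrite sum_nat_const card_ord natrM mulrAC mulfV ?mul1r // pnatr_eq0 -lt0n.
transitivity (#|predC1 x|); last by rewrite cardC1 card_ord.
by rewrite -sum1_card [RHS]big_mkcond; apply: eq_bigr => y _;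
  rewrite /complete_adj eq_sym inE /=; case: eqP.
Qed.
End Complete.

(** In [complete m], fewer than [2 s] vertices leave no room for [Kst s s], the average degree
    [m - 1] reaches every integer [D < m], and at most [k] vertices cannot give average degree
    [k]. *)
Lemma f_Ind_ge_small (R : realType) (m s k : nat) :
  (0 < m)%N -> (m <= k)%N -> (m < 2 * s)%N -> (m%:R%:E <= f_Ind R s k)%E.
Proof.
move=> m0 mk ms; apply: le_ereal_inf_tmp => _ [D hD <-].
rewrite lee_fin leNgt; apply/negP; rewrite -(mulrz_nat m) ltr_int => Dm.
have [| |S [_ /avgdeg_ge]] := hD (complete m).
- case=> f [finj _]; have := leq_card f finj; rewrite card_sum !card_ord; lia.
- rewrite avgdeg_complete // -(mulrz_nat m.-1) ler_int; lia.
case; first lia.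
have := edges_le (Defs.induced S).
have : (#|Defs.induced S| <= m)%N by rewrite card_sig (leq_trans (max_card _)) ?card_ord.
set e := #|edges _|; set c := #|_|; case: c => // c cm h1 _ h2.
have : (k * c.+1 <= c * c.+1)%N by rewrite (leq_trans h2) // (leq_trans h1) // mulnC.
by rewrite leq_pmul2r // leqNgt (leq_trans cm mk).
Qed.

(** Settles every case in which the claimed exponent is at most 0. *)
Lemma f_Ind_ge1 (R : realType) (s k : nat) : (0 < s)%N -> (0 < k)%N ->
  (1%:E <= f_Ind R s k)%E.
Proof. by move=> s0 k0; apply: (@f_Ind_ge_small R 1) => //; lia. Qed.

(** * Numerical estimates *)

Lemma nat_root (d k : nat) : (0 < d)%N -> exists q, (q ^ d <= k < q.+1 ^ d)%N.
Proof.
move=> d0; elim: k => [|k [q /andP[h1 h2]]]; first by exists 0%N; rewrite exp0n ?exp1n.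
have [h|h] := leqP (q.+1 ^ d) k.+1.
  by exists q.+1; rewrite h (leq_ltn_trans h2) // ltn_exp2r.
by exists q; rewrite h (leq_trans h1).
Qed.

(** With [u] the integer square root of [r], [r < (u + 1) ^ 2 <= 2 ^ (2 u)], so
    [r ^ d <= 2 ^ (2 d u) <= 2 ^ (u ^ 2)]. *)
Lemma expn_le_exp2 (d r : nat) : (4 * d ^ 2 <= r)%N -> (r ^ d <= 2 ^ r)%N.
Proof.
move=> dr; have [u /andP[h1 h2]] := @nat_root 2 r isT.
have du : (2 * d <= u)%N.
  by rewrite -ltnS -(@ltn_exp2r _ _ 2) // (leq_ltn_trans _ h2) // expnMn.
apply: leq_trans (_ : 2 ^ (u ^ 2) <= _)%N; last by rewrite leq_exp2l.
apply: leq_trans (_ : (2 ^ u) ^ (2 * d) <= _)%N; last first.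
  by rewrite -expnM leq_exp2l // -mulnn leq_mul2l du orbT.
have [->|d0] := posnP d; first by rewrite expn0.
rewrite expnM leq_exp2r // (leq_trans (ltnW h2)) // leq_exp2r //.
exact: ltn_expl.
Qed.

Lemma pow_1B_inv_le_half (R : realFieldType) (r : nat) : (0 < r)%N ->
  (1 - r%:R^-1) ^+ r <= 2^-1 :> R.
Proof.
move=> r0; have rR : 1 <= r%:R :> R by rewrite ler1n.
have z : -1 <= - r%:R^-1 :> R by rewrite lerN2 invf_le1 ?ltr0n.
have := expr1D_le r z; rewrite mulrN mulfV ?pnatr_eq0 -?lt0n //; lra.
Qed.

(** For edge probability [1 / q] and [t = 2] the fraction is [1 - 1 / (2 q)]; each [2 q] factors
    halve it, and the final factor [t] costs one halving, hence [j.+1]. *)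
Lemma chernoff_base_le_exp2 (R : realFieldType) (q k j : nat) : (0 < q)%N ->
  (2 * q * j.+1 <= k.-1)%N -> chernoff_base R 1 q k 2 <= 2^-1 ^+ j.
Proof.
move=> q0 hk; rewrite /chernoff_base.
have q2 : (0 < 2 * q)%N by rewrite muln_gt0.
have -> : (1 + (q - 1) * 2)%:R / (q * 2)%:R = 1 - (2 * q)%:R^-1 :> R.
  rewrite (_ : 1 + (q - 1) * 2 = 2 * q - 1)%N; last by lia.
  by rewrite natrB // mulrBl [(q * 2)%N]mulnC mulfV ?pnatr_eq0 -?lt0n // mul1r.
have z1 : (2 * q)%:R^-1 <= 1 :> R by rewrite invf_le1 ?ltr0n // ler1n.
have z0 : 0 <= (2 * q)%:R^-1 :> R by rewrite invr_ge0 ler0n.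
apply: (@le_trans _ _ ((1 - (2 * q)%:R^-1) ^+ (2 * q * j.+1) * 2)).
  rewrite ler_wpM2r // ler_wiXn2l //; lra.
rewrite exprM -ler_pdivlMr // -exprSr.
apply: lerXn2r; rewrite ?nnegrE ?invr_ge0 // ?exprn_ge0 ?subr_ge0 //.
exact: pow_1B_inv_le_half.
Qed.

Lemma eventually_zero_cvg (R : realType) (o : nat -> R) (N : nat) :
  (forall k, (N <= k)%N -> o k = 0) -> o @ \oo --> (0 : R).
Proof.
move=> h; apply/cvgrPdist_lt => e e0; exists N => // k /= Nk.
by rewrite h // subrr normr0.
Qed.

Lemma cvg_div_ln (R : realType) (c : R) : (fun k : nat => c / ln k%:R) @ \oo --> (0 : R).
Proof.
apply/cvgrPdist_lt => e e0.
near=> k.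
have hk : expR ((`|c| + 1) / e) <= k%:R by near: k; exact: nbhs_infty_ger.
have k0 : 0 < k%:R :> R by apply: lt_le_trans hk; exact: expR_gt0.
have : (`|c| + 1) / e <= ln k%:R.
  by rewrite -ler_expR lnK ?posrE.
have c1 : 0 < (`|c| + 1) / e by rewrite divr_gt0 // ltr_pwDr.
move=> hl; have l0 := lt_le_trans c1 hl.
rewrite sub0r normrN normrM normfV (gtr0_norm l0) ltr_pdivrMr // mulrC.
move: hl; rewrite ler_pdivrMr // => hl; lra.
Unshelve. all: by end_near.
Qed.

(** Shows that the bound [(n - 1) / (k - 1)] is at least [y]. *)
Lemma leq_mul_pred (y k n : nat) :
  (0 < y)%N -> (y * (2 * k) <= n)%N -> (y * k.-1 <= n.-1)%N.
Proof. by case: k => [|k] y0 /= h; nia. Qed.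

(** * The diagonal case [s = k] *)

Lemma diagonal_large (R : realType) (k q : nat) : (4 <= q)%N ->
  (q ^ 4 <= k < q.+1 ^ 4)%N -> (((q ^ (k./2 - 10))%:R : R)%:E <= f_Ind R k k)%E.
Proof.
move=> q4 /andP[qk kq].
have k256 : (256 <= k)%N by apply: leq_trans qk; rewrite (leq_exp2r 4 q (isT : 0 < 4)%N).
have q0 : (0 < q)%N by lia.
have kq8 : (k <= q ^ 8)%N.
  apply: ltnW; apply: leq_trans kq _; rewrite (expnM q 2 4) leq_exp2r //; nia.
have qq : (2 * q * (2 * q).+1 <= k.-1)%N.
  have : (16 * q ^ 2 <= q ^ 4)%N.
    by rewrite (expnD q 2 2) leq_mul2r (leq_exp2r 4 q (isT : 0 < 2)%N) q4 orbT.
  nia.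
have := chernoff_base_le_exp2 R q0 qq; set x := chernoff_base _ _ _ _ _ => xle.
have x0 : 0 <= x by exact: chernoff_base_ge0.
(* The [- 1] leaves a spare factor [q >= 4], so that [4 n ^ 2 <= q ^ k]. *)
pose h := (k./2 - 1)%N; pose n := (q ^ h)%N.
have h2 : (2 * h + 1 <= k)%N by rewrite /h; lia.
have n0 : (0 < n)%N by rewrite expn_gt0 q0.
have nk : (4 * k <= n)%N.
  apply: (@leq_trans (q ^ 9)); first by rewrite (expnS q 8) leq_mul.
  by rewrite leq_pexp2l // /h; lia.
apply: (@le_trans _ _ (n.-1%:R / k.-1%:R)%:E).
  rewrite lee_fin ler_pdivlMr ?ltr0n; last by lia.
  rewrite -natrM ler_nat.
  (* The nine powers of [q] given up pay for [2 k <= q ^ 9]. *)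
  have -> : (k./2 - 10 = h - 9)%N by rewrite /h; lia.
  apply: leq_mul_pred; first by rewrite expn_gt0 q0.
  apply: (@leq_trans (q ^ (h - 9) * q ^ 9)).
    by rewrite (expnS q 8) leq_mul2l leq_mul ?orbT //; lia.
  by rewrite -expnD subnK // /h; lia.
apply: (@f_Ind_ge R n 1 q k k 2) => //; try lia.
- apply: le_trans xle _; rewrite -[leRHS]expr1 ler_wiXn2l ?invr_ge0 ?invf_le1 ?ler1n //; lia.
- apply: (@le_trans _ _ ((4 * n)%:R ^+ 2 * (2^-1 ^+ (2 * q)) ^+ k)).
    by rewrite ler_wpM2l ?exprn_ge0 // lerXn2r ?nnegrE ?exprn_ge0 ?invr_ge0.
  rewrite -exprM exprVn ler_pdivrMr ?exprn_gt0 // mul1r -!natrX ler_nat.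
  apply: (@leq_trans (q ^ (2 * k))).
    rewrite expnMn /n -expnM; apply: (@leq_trans (q ^ 2 * q ^ (h * 2))).
      by rewrite leq_mul2r (leq_exp2r 4 q (isT : 0 < 2)%N) q4 orbT.
    by rewrite -expnD leq_pexp2l //; lia.
  rewrite [leqRHS](_ : _ = (2 ^ q) ^ (2 * k))%N; last by rewrite -expnM; congr (2 ^ _)%N; lia.
  by rewrite leq_exp2r ?(ltnW (ltn_expl _ _)) //; lia.
- nia.
- rewrite exp1n muln1 /n -expnM; apply: (@leq_trans (q * q ^ (h * 2))).
    by rewrite leq_mul2r q4 orbT.
  by rewrite -expnS leq_pexp2l //; lia.
Qed.

(** The constant is [2048 = 8 * 256]. For large [k], [k <= q ^ 8] leaves exponent [k / 256], below
    [k./2 - 10]; for [k <= 256 = 2 ^ 8] the claimed bound is at most 2. *)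
Lemma diagonal (R : realType) (k : nat) : (2 <= k)%N ->
  ((k%:R `^ (2048%:R^-1 * k%:R))%:E <= f_Ind R k k)%E.
Proof.
move=> k2; have k1R : 1 <= k%:R :> R by rewrite ler1n; lia.
have c0 : 0 <= 2048%:R^-1 * k%:R :> R by rewrite mulr_ge0 ?invr_ge0 ?ler0n.
have [q /andP[h1 h2]] := @nat_root 4 k isT.
have [q4|q4] := leqP 4 q.
  have k256 : (256 <= k)%N by apply: leq_trans h1; rewrite (leq_exp2r 4 q (isT : 0 < 4)%N).
  apply: le_trans (diagonal_large R q4 _); last by rewrite h1 h2.
  have q1R : 1 <= q%:R :> R by rewrite ler1n; lia.
  rewrite lee_fin natrX -powR_mulrn ?ler0n //.
  apply: (@le_trans _ _ ((q%:R ^+ 8) `^ (2048%:R^-1 * k%:R))).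
    apply: ge0_ler_powR => //; rewrite ?nnegrE ?exprn_ge0 // -natrX ler_nat.
    apply: ltnW; apply: leq_trans h2 _; rewrite (expnM q 2 4) leq_exp2r //; nia.
  rewrite -powR_mulrn ?ler0n // -powRrM ler_powR //.
  have : (k <= 4 * (k./2 - 10))%N by lia.
  rewrite -(ler_nat R) natrM; have : 0 <= k%:R :> R by rewrite ler0n.
  lra.
have k256 : (k <= 256)%N.
  by apply: ltnW; apply: leq_trans h2 _; rewrite (leq_exp2r q.+1 4 (isT : 0 < 4)%N).
apply: (@le_trans _ _ 2%:E); last by apply: (@f_Ind_ge_small R 2) => //; lia.
rewrite lee_fin; have kR : k%:R <= 256 :> R by rewrite (ler_nat R k 256).
apply: (@le_trans _ _ ((2 ^+ 8) `^ (2048%:R^-1 * k%:R))).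
  apply: ge0_ler_powR => //; rewrite ?nnegrE ?exprn_ge0 //.
  by apply: le_trans kR _; rewrite -natrX.
rewrite -powR_mulrn // -powRrM.
have e1 : 8 * (2048%:R^-1 * k%:R) <= 1 :> R by lra.
apply: (@le_trans _ _ (2 `^ 1)); last by rewrite powRr1.
by apply: ler_powR e1; rewrite ler1n.
Qed.

(** * The case of fixed [k] *)

(** Here [r] is about the square root of [s], the edge probability is [1 - 1 / r], [t = r] and
    [n = r ^ (k (k - 3) / 2)]. The extra factor [r] of [n] over [r ^ M] pays for [2 ^ M * 2 * k]. *)
Lemma fixed_k_large (R : realType) (k M r s : nat) : (4 <= k)%N ->
  (2 * M + 2 = k * (k - 3))%N -> (r ^ 2 <= s)%N ->
  (2 ^ M * 2 * k <= r)%N -> (16 * 2 ^ k.-1 <= r)%N -> (4 * k <= r)%N ->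
  (4 * (2 * M + 3) ^ 2 <= r)%N ->
  ((((2 * r) ^ M)%N%:R : R)%:E <= f_Ind R s k)%E.
Proof.
move=> k4 Mk rs rM rC rk rexp.
have r0 : (0 < r)%N by lia.
have rR : 0 < r%:R :> R by rewrite ltr0n.
pose n := (r ^ M.+1)%N.
have nr : (r <= n)%N by rewrite /n -{1}(expn1 r) leq_pexp2l.
pose C : R := 2 ^+ k.-1.
have C1 : 1 <= C by rewrite exprn_ege1 // ler1n.
have CR : 16 * C <= r%:R by rewrite /C -natrX -natrM ler_nat.
(* The fraction is [(2 r - 1) / r ^ 2 <= 2 / r]; the factor [t = r] lowers the exponent of [r] by
   one. *)
have xle : chernoff_base R r.-1 r k r <= C / r%:R ^+ (k - 2).
  rewrite /chernoff_base (_ : k - 2 = k.-1.-1)%N; last by lia.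
  have rE : r%:R = r%:R ^+ k.-1 / r%:R ^+ k.-1.-1 :> R.
    have -> : k.-1 = k.-1.-1.+1 by lia.
    by rewrite exprS mulfK // expf_neq0 // gt_eqF.
  rewrite [X in _ * X <= _]rE mulrA ler_wpM2r ?invr_ge0 ?exprn_ge0 ?ler0n //.
  rewrite -exprMn lerXn2r ?nnegrE //.
  rewrite mulrAC ler_pdivrMr ?ltr0n ?muln_gt0 ?r0 // -!natrM ler_nat.
  by rewrite (_ : r - r.-1 = 1)%N ?mul1n ?mulnA ?leq_mul2r; lia.
have x0 := chernoff_base_ge0 R r.-1 r k r.
have r1 : 1 <= r%:R :> R by rewrite ler1n.
apply: (@le_trans _ _ (n.-1%:R / k.-1%:R)%:E).
  rewrite lee_fin ler_pdivlMr ?ltr0n; last by lia.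
  rewrite -natrM ler_nat.
  apply: leq_mul_pred; first by rewrite expn_gt0 muln_gt0 r0.
  by rewrite expnMn /n expnS mulnC mulnA leq_mul2r mulnC mulnA rM orbT.
apply: (@f_Ind_ge R n r.-1 r s k r) => //; try lia.
- apply: le_trans xle _; rewrite ler_pdivrMr ?exprn_gt0 //.
  have : r%:R ^+ 1 <= r%:R ^+ (k - 2) :> R by rewrite ler_weXn2l //; lia.
  rewrite expr1; lra.
- apply: (@le_trans _ _ ((4 * n)%:R ^+ 2 * (C / r%:R ^+ (k - 2)) ^+ k)).
    by rewrite ler_wpM2l ?exprn_ge0 // lerXn2r ?nnegrE ?divr_ge0 ?exprn_ge0
               ?ler0n // (le_trans _ C1).
  rewrite expr_div_n mulrA ler_pdivrMr ?exprn_gt0 // mul1r -[leRHS]exprM.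
  (* Beyond [n ^ 2], a factor [r ^ k] remains to absorb the constants [16 * C ^ k]. *)
  rewrite (_ : (k - 2) * k = k + 2 * M.+1)%N; last by nia.
  rewrite exprD /n natrM natrX exprMn -exprM [(2 * _)%N]mulnC mulrAC ler_wpM2r ?exprn_ge0 ?ler0n //.
  apply: (@le_trans _ _ ((16 * C) ^+ k)); last first.
    by rewrite lerXn2r ?nnegrE ?mulr_ge0 ?ler0n // (le_trans _ C1).
  rewrite exprMn ler_wpM2r ?exprn_ge0 // ?(le_trans _ C1) //.
  rewrite -!natrX ler_nat; rewrite (_ : 4 ^ 2 = 16 ^ 1)%N // leq_exp2l //; lia.
- have : (n * 3 <= n * n.-1)%N by rewrite leq_mul2l; apply/orP; right; lia.
  lia.
- rewrite -(ler_nat R) natrM [in leRHS]natrX [(r.-1 ^ s)%:R]natrX.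
  have -> : r.-1%:R = (1 - r%:R^-1) * r%:R :> R.
    by rewrite mulrBl mulVf ?gt_eqF // mul1r -subn1 natrB.
  rewrite exprMn mulrA -[leRHS]mul1r ler_wpM2r ?exprn_ge0 ?ler0n //.
  have z1 : 0 <= 1 - r%:R^-1 :> R by rewrite subr_ge0 invf_le1.
  apply: (@le_trans _ _ ((4 * n ^ 2)%:R * 2^-1 ^+ r)).
    rewrite ler_wpM2l ?ler0n //.
    apply: (@le_trans _ _ ((1 - r%:R^-1) ^+ (r ^ 2))).
      by rewrite ler_wiXn2l // gerBl invr_ge0 ler0n.
    rewrite -mulnn exprM lerXn2r ?nnegrE ?exprn_ge0 ?invr_ge0 //.
    exact: pow_1B_inv_le_half.
  rewrite exprVn ler_pdivrMr ?exprn_gt0 // mul1r -natrX ler_nat.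
  apply: leq_trans (expn_le_exp2 rexp).
  rewrite /n -expnM (_ : 2 * M + 3 = (M.+1 * 2).+1)%N ?expnS ?leq_mul2r; lia.
Qed.

Lemma fixed_k (R : realType) (k : nat) : (2 <= k)%N ->
  exists o : nat -> R, o @ \oo --> (0 : R) /\
    forall s : nat, (1 <= s)%N ->
      ((s%:R `^ ((4^-1 - o s) * (k%:R ^+ 2 - 3 * k%:R - 2)))%:E
         <= f_Ind R s k)%E.
Proof.
move=> k2; have [k4|k4] := leqP 4 k; last first.
  exists (fun=> 0); split; first exact: cvg_cst.
  move=> s s1; apply: le_trans (f_Ind_ge1 R s1 _); last by lia.
  rewrite lee_fin; apply: (@le_trans _ _ (s%:R `^ 0)); last by rewrite powRr0.
  rewrite ler_powR ?ler1n //.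
  have : k%:R <= 3 :> R by rewrite (ler_nat R k 3).
  have : 2 <= k%:R :> R by rewrite (ler_nat R 2 k).
  nra.
(* [k] and [k - 3] have opposite parity. Then [2 M = k ^ 2 - 3 k - 2] is the factor in the
   exponent. *)
have [M Mk] : exists M, (2 * M + 2 = k * (k - 3))%N.
  have ev : ~~ odd (k * (k - 3)) by rewrite oddM oddB ?[(3 <= k)%N]ltnW //; case: odd.
  exists ((k * (k - 3))./2 - 1)%N; have := even_halfK ev; nia.
pose r0 := (2 ^ M * 2 * k + 16 * 2 ^ k.-1 + 4 * k + 4 * (2 * M + 3) ^ 2)%N.
(* Below the threshold, 1/4 makes the exponent 0; above it no error term remains, as
   [s < (r + 1) ^ 2 <= (2 r) ^ 2]. *)
exists (fun s => if (s < r0 ^ 2)%N then 4^-1 else 0); split.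
  by apply: (@eventually_zero_cvg R _ (r0 ^ 2)) => s hs; rewrite ltnNge hs.
move=> s s1; case: ltnP => hs.
  by rewrite subrr mul0r powRr0; apply: f_Ind_ge1; lia.
have [r /andP[h1 h2]] := @nat_root 2 s isT.
have rr : (r0 <= r)%N by rewrite -ltnS -(@ltn_exp2r _ _ 2) // (leq_ltn_trans hs).
apply: le_trans (@fixed_k_large R k M r s _ _ _ _ _ _ _) => //; try (rewrite /r0 in rr; lia).
have kR : k%:R ^+ 2 - 3 * k%:R - 2 = 2 * M%:R :> R.
  have := congr1 (fun n => n%:R : R) Mk; rewrite natrD !natrM natrB; last by lia.
  lra.
rewrite lee_fin subr0 kR.
have -> : 4^-1 * (2 * M%:R) = 2^-1 * M%:R :> R by field.
apply: (@le_trans _ _ (((2 * r)%:R ^+ 2) `^ (2^-1 * M%:R))).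
  apply: ge0_ler_powR; rewrite ?nnegrE ?mulr_ge0 ?invr_ge0 ?exprn_ge0 ?ler0n //.
  rewrite -natrX ler_nat; apply: ltnW; apply: leq_trans h2 _.
  by rewrite leq_exp2r //; rewrite /r0 in rr; lia.
rewrite -powR_mulrn ?ler0n // -powRrM mulrA mulfV // mul1r powR_mulrn ?ler0n //.
by rewrite natrX.
Qed.

(** * The case of fixed [s] *)

Lemma fixed_s_large (R : realType) (s k : nat) : (3 <= s)%N ->
  (* The first term serves [expn_le_exp2] with exponent [s.+1]; 1024 ensures [q >= 64] below. *)
  (4 * s.+1 ^ 2 + 1024 <= k)%N ->
  exists n, (k ^ s <= 8 ^ s * (4 * n.+1 ^ 2))%N /\
    (((n.+1%:R / (2 * k%:R)) : R)%:E <= f_Ind R s k)%E.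
Proof.
move=> s3 ks; pose q := (k.-1 %/ 4)%N.
have q64 : (64 <= q)%N by rewrite /q; lia.
have k8 : (k <= 8 * q)%N by rewrite /q; lia.
have k4 : (4 * q <= k.-1)%N by rewrite /q; lia.
have kq : (k <= 4 * q + 4)%N by rewrite /q; lia.
(* The largest [n] with [4 n ^ 2 <= q ^ s], as the exclusion of [Kst s s] requires. *)
have [n /andP[h1 h2]] := @nat_root 2 (q ^ s %/ 4) isT.
have n1 : (4 * n ^ 2 <= q ^ s)%N by lia.
have n2 : (q ^ s <= 4 * n.+1 ^ 2)%N by lia.
have nq : (1024 * q <= n.+1 ^ 2)%N.
  have : (q ^ 3 <= q ^ s)%N by rewrite leq_pexp2l //; lia.
  have : (64 * 64 * q <= q ^ 3)%N by rewrite !expnS expn0 muln1; nia.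
  lia.
have n255 : (255 <= n)%N by nia.
exists n; split.
  apply: leq_trans (_ : (8 * q) ^ s <= _)%N; first by rewrite leq_exp2r //; lia.
  by rewrite expnMn leq_mul2l n2 orbT.
apply: (@le_trans _ _ (n.-1%:R / k.-1%:R)%:E).
  rewrite lee_fin ler_pdivlMr ?ltr0n; last by lia.
  rewrite mulrAC ler_pdivrMr ?mulr_gt0 ?ltr0n //; last by lia.
  rewrite -!natrM ler_nat; nia.
(* The divisor 4 in [q] is exactly what [j = 1] requires. *)
have xle : chernoff_base R 1 q k 2 <= 2^-1 ^+ 1.
  by apply: chernoff_base_le_exp2; lia.
have x0 := chernoff_base_ge0 R 1 q k 2.
apply: (@f_Ind_ge R n 1 q s k 2) => //; try lia.
- apply: (@le_trans _ _ ((4 * n)%:R ^+ 2 * 2^-1 ^+ k)).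
    by rewrite ler_wpM2l ?exprn_ge0 // lerXn2r ?nnegrE ?invr_ge0 // -[leRHS]expr1.
  rewrite exprVn ler_pdivrMr ?exprn_gt0 // mul1r -!natrX ler_nat.
  apply: leq_trans (@expn_le_exp2 s.+1 k _); last by lia.
  have : (q ^ s * (4 * q) <= k ^ s * k)%N.
    by rewrite leq_mul //; [rewrite leq_exp2r; lia | lia].
  rewrite -expnSr; nia.
- by rewrite exp1n muln1.
Qed.

Lemma fixed_s (R : realType) (s : nat) : (2 <= s)%N ->
  exists o : nat -> R, o @ \oo --> (0 : R) /\
    forall k : nat, (1 <= k)%N ->
      ((k%:R `^ ((2^-1 - o k) * s%:R - 1))%:E <= f_Ind R s k)%E.
Proof.
move=> s2; have [s3|s3] := leqP 3 s; last first.
  exists (fun=> 0); split; first exact: cvg_cst.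
  move=> k k1; have -> : s = 2 by lia.
  by rewrite subr0 mulVf // subrr powRr0; apply: f_Ind_ge1.
pose k0 := (4 * s.+1 ^ 2 + 1024)%N.
have sR : 0 < s%:R :> R by rewrite ltr0n; lia.
(* For small [k] the exponent becomes 0; for large [k], [k ^ (o k)] is 8, so the error term is worth
   the constant [8 ^ s]. *)
exists (fun k => if (k < k0)%N then 2^-1 - s%:R^-1 else ln 8 / ln k%:R); split.
  apply: cvg_trans (@cvg_div_ln R (ln 8)); apply: near_eq_cvg.
  by exists k0 => // k /= hk; rewrite ltnNge hk.
move=> k k1; case: ltnP => hk.
  rewrite opprB addrCA subrr addr0 mulVf ?gt_eqF // subrr powRr0.
  by apply: f_Ind_ge1; lia.
have [n [kn fn]] := fixed_s_large R s3 hk; apply: le_trans fn.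
have kR : 1 < k%:R :> R by rewrite ltr1n; rewrite /k0 in hk; lia.
have kR0 : 0 < k%:R :> R by apply: lt_trans kR.
have lnk : 0 < ln k%:R :> R by rewrite ln_gt0.
have kN : k%:R != 0 :> R by rewrite gt_eqF.
rewrite lee_fin mulrBl powRB; last by rewrite kN implybT.
rewrite powRB; last by rewrite kN implybT.
rewrite powRr1 ?ler0n // (_ : n.+1%:R / (2 * k%:R) = n.+1%:R / 2 / k%:R);
  last by rewrite invfM mulrA.
rewrite ler_wpM2r ?invr_ge0 ?ler0n //.
rewrite [_ `^ (ln 8 / _ * _)]powRrM.
have -> : k%:R `^ (ln 8 / ln k%:R) = 8 :> R.
  rewrite /powR gt_eqF // divfK ?gt_eqF // lnK // posrE ltr0n //.
rewrite powR_mulrn ?ler0n // ler_pdivrMr ?exprn_gt0 //.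
(* Squaring removes the exponent [s / 2]. One factor [8 ^ s] then matches [kn]; the other, at least
   64, absorbs the remaining constant 16. *)
rewrite -(@ler_pXn2r _ 2) // ?nnegrE ?powR_ge0 ?mulr_ge0 ?exprn_ge0 ?invr_ge0 ?ler0n //.
rewrite -[leLHS]powR_mulrn ?powR_ge0 // -powRrM mulrAC mulVf // mul1r powR_mulrn ?ler0n //.
apply: (@le_trans _ _ (8 ^+ s * (4 * n.+1%:R ^+ 2))).
  by rewrite -!natrX -!natrM ler_nat.
have h8 : 8 ^+ 2 <= 8 ^+ s :> R by rewrite ler_weXn2l ?ler1n.
have e0 : 0 <= n.+1%:R ^+ 2 :> R by rewrite exprn_ge0.
have e8 : 0 <= 8 ^+ s :> R by rewrite exprn_ge0.
have : 64 * n.+1%:R ^+ 2 <= 8 ^+ s * n.+1%:R ^+ 2 :> R by rewrite ler_wpM2r //; lra.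
have -> : (n.+1%:R / 2 * 8 ^+ s) ^+ 2 = 8 ^+ s * (8 ^+ s * n.+1%:R ^+ 2 / 4) :> R by field.
move=> h; rewrite ler_wpM2l //; lra.
Qed.

Theorem theorem1p3 (R : realType) :
  (exists c : R, 0 < c /\
     forall k : nat, (2 <= k)%N ->
       ((k%:R `^ (c * k%:R))%:E <= f_Ind R k k)%E)
  /\
  (forall k : nat, (2 <= k)%N ->
     exists o : nat -> R, o @ \oo --> (0 : R) /\
       forall s : nat, (1 <= s)%N ->
         ((s%:R `^ ((4^-1 - o s) * (k%:R ^+ 2 - 3 * k%:R - 2)))%:E
            <= f_Ind R s k)%E)
  /\
  (forall s : nat, (2 <= s)%N ->
     exists o : nat -> R, o @ \oo --> (0 : R) /\
       forall k : nat, (1 <= k)%N ->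
         ((k%:R `^ ((2^-1 - o k) * s%:R - 1))%:E <= f_Ind R s k)%E).
Proof.
split; last by split; [exact: fixed_k | exact: fixed_s].
by exists 2048%:R^-1; split; [rewrite invr_gt0 ltr0n | exact: diagonal].
Qed.
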